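(* Let $p$ be a prime, let $m\geq 2$ be an integer with $\gcd(p,m)=1$, and let $k$ be a nonnegative integer. Then $$\Psi_{p^km}(x)\equiv \Psi_m(x)^{\varphi(p^k)}\pmod p,$$ i.e., the congruence holds coefficientwise in $\mathbb{Z}[x]$.
   Context: The Fibonacci polynomials are defined by $F_1(x)=1$, $F_2(x)=x$, and $F_n(x)=xF_{n-1}(x)+F_{n-2}(x)$ for $n\geq 3$. For $n\geq 2$, the $n$-th fibotomic polynomial $\Psi_n(x)\in\mathbb{Z}[x]$ is the product of the monic irreducible factors of $F_n(x)$ which are not factors of $F_k(x)$ for any $k<n$; also $\Psi_1(x)=1$. $\varphi$ is Euler's totient function. *)

(* Defs.v *)
From HB Require Import structures.
From mathcomp Require Import all_boot all_order all_algebra.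
From Stdlib Require Import ClassicalEpsilon.
Set Implicit Arguments. Unset Strict Implicit. Unset Printing Implicit Defensive.
Import Order.TTheory GRing.Theory Num.Theory.
Local Open Scope ring_scope.

Fixpoint fibpoly (n : nat) : {poly int} :=
  match n with
  | 0 => 0
  | 1 => 1
  | (n'.+1 as k).+1 => 'X * fibpoly k + fibpoly n'
  end.

Definition zdvdp (q f : {poly int}) : Prop := exists r : {poly int}, f = q * r.

Definition monic_irr (q : {poly int}) : Prop := q \is monic /\ irreducible_poly q.

(* P is the product of the (distinct) monic irreducible factors of F_n that
   do not divide any F_k with 0 < k < n; for n <= 1, P = 1. *)
Definition is_fibotomic (n : nat) (P : {poly int}) : Prop :=
  if (n <= 1)%N then P = 1 else
  [/\ P \is monic,
      (forall q, monic_irr q ->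
         (zdvdp q P <-> (zdvdp q (fibpoly n) /\
                         forall k : nat, (0 < k < n)%N -> ~ zdvdp q (fibpoly k))))
    & (forall q, monic_irr q -> ~ zdvdp (q * q) P)].

(* the n-th fibotomic polynomial Psi_n (unique polynomial with the above property) *)
Definition fibotomic (n : nat) : {poly int} :=
  epsilon (inhabits 0) (is_fibotomic n).

(* Main.v *)
Require Import Defs.
From mathcomp Require Import all_boot all_order all_algebra.
From mathcomp Require Import ring.
From Stdlib Require Import Classical ClassicalEpsilon.
Import GRing.Theory Num.Theory.
Local Open Scope ring_scope.

(** Every irreducible factor q of F_n has a rank of apparition d, the least
    positive index with q | F_d, and q | F_n iff d | n. Since F_n is squarefree,
    as (x^2 + 4) F_n' = n (2 F_(n+1) - x F_n) - x F_n and F_n, F_(n+1) are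
    coprime, this gives F_n = prod_(d | n) Psi_d. Modulo p, the Frobenius map
    applied to powers of the matrix [[x, 1], [1, 0]] gives F_(pn) = F_p F_n^p.
    Comparing F_(p^(k+1) m) with F_(p^k m) yields, for m prime to p,
      prod_(d | m) Psi_(p^(k+1) d) = Psi_(p^(k+1)) prod_(d | m) Psi_d^phi(p^(k+1)),
    and induction on m cancels the factors with d < m. *)

(** * Monic factors of integer polynomials *)

(* [%|] on {poly int} is pseudo-division, that is, divisibility over the rationals;
   for a monic divisor it is genuine divisibility. *)
Lemma zdvdpP (q f : {poly int}) : q \is monic -> zdvdp q f <-> q %| f.
Proof.
move=> qm; split=> [[r ->]|/(Pdiv.IdomainMonic.dvdpP qm)[r ->]].
  exact: dvdp_mulr.
by exists r; rewrite mulrC.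
Qed.

Lemma monic_irr_coprime (q f : {poly int}) :
  monic_irr q -> coprimep q f = ~~ (q %| f).
Proof. by case=> _; apply: irreducible_poly_coprime. Qed.

Lemma monic_irr_dvdM (q f g : {poly int}) :
  monic_irr q -> q %| f * g -> (q %| f) || (q %| g).
Proof.
move=> qi; have [//|nqf] := boolP (q %| f).
by rewrite Gauss_dvdpr // monic_irr_coprime.
Qed.

Lemma monic_irr_dvd1 (q : {poly int}) : monic_irr q -> ~~ (q %| 1).
Proof. by move=> [_ [sq _]]; rewrite dvdp1 neq_ltn sq orbT. Qed.

Lemma monic_irr_eq (q r : {poly int}) :
  monic_irr q -> monic_irr r -> q %| r -> q = r.
Proof.
move=> [qm [sq _]] [rm ri] qr; apply/eqP; rewrite -eqp_monic //.
by apply: apply_irredp => //; rewrite neq_ltn sq orbT.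
Qed.

(** The leading coefficients multiply to 1 in Z, so both equal the same sign, and this sign is the
    [c] that makes both factors monic. *)
Lemma monic_mul_signed (f g : {poly int}) : f * g \is monic ->
  exists c : int, [/\ c * c = 1, c *: f \is monic & c *: g \is monic].
Proof.
rewrite monicE lead_coefM => /eqP fg; exists (lead_coef f).
rewrite !monicE !lead_coefZ.
have ff : lead_coef f * lead_coef f = 1.
  have := intUnitRing.unitzPl (etrans (mulrC _ _) fg).
  by case/orP=> /eqP->; rewrite ?mulrNN mulr1.
by rewrite ff fg.
Qed.

(** A form of Gauss's lemma: the primitive part of a rational divisor of [f] divides [f] over the
    integers, and a sign makes it monic. *)
Lemma monic_dvd_factor (q f : {poly int}) : f \is monic -> q %| f ->
  exists g h : {poly int}, [/\ f = g * h, g \is monic, h \is monic & g %= q].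
Proof.
move=> fm /dvdpP_int[h fE]; have := fm; rewrite fE => /monic_mul_signed.
move=> [c [cc gm hm]]; exists (c *: zprimitive q), (c *: h); split=> //.
  by rewrite -scalerAl -scalerAr scalerA cc scale1r.
have c0 : c != 0 by apply: contra_eqN cc => /eqP->; rewrite mul0r.
apply: eqp_trans (eqp_scale _ c0) _.
have q0 : q != 0.
  apply: contraTneq gm => ->.
  by rewrite zprimitive0 scaler0 monicE lead_coef0.
by rewrite {2}(zpolyEprim q) eqp_sym; apply: eqp_scale; rewrite zcontents_eq0.
Qed.

Lemma monic_irr_factor (f : {poly int}) : f \is monic -> f != 1 ->
  exists q g, [/\ f = q * g, monic_irr q & g \is monic].
Proof.
have [n] := ubnP (size f); elim: n f => // n IHn f sf fm f1.
have f0 := monic_neq0 fm.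
have sf1 : (1 < size f)%N.
  rewrite ltn_neqAle size_poly_gt0 f0 andbT eq_sym.
  apply: contra f1 => sf1; rewrite -eqp_monic ?monic1 //.
  by rewrite -size_poly_eq1.
have [fi|nfi] := classic (irreducible_poly f).
  by exists f, 1; rewrite mulr1 monic1.
have [q [sq qf nqf]] : exists q : {poly int}, [/\ size q != 1%N, q %| f & ~~ (q %= f)].
  apply: NNPP => nq; apply: nfi; split=> // q sq qf.
  by apply/idPn => nqf; apply: nq; exists q.
have [g [h [fE gm hm gq]]] := monic_dvd_factor _ _ fm qf.
have sg : size g = size q by apply: eqp_size.
have gltf : (size g < size f)%N.
  have gf : g %| f by rewrite fE dvdp_mulr.
  rewrite ltn_neqAle dvdp_leq // andbT.
  apply: contra nqf => sgf; rewrite -(eqp_ltrans gq) -dvdp_size_eqp //.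
have g1 : g != 1 by apply: contra sq => /eqP g1; rewrite -sg g1 size_poly1.
have [|r [s [gE ri sm]]] := IHn g _ gm g1.
  by apply: leq_trans gltf _; rewrite -ltnS.
exists r, (s * h); split=> //; first by rewrite fE gE mulrA.
by rewrite monicMl.
Qed.

Lemma size_monic_irrM (q f : {poly int}) :
  monic_irr q -> f \is monic -> (size f < size (q * f)%R)%N.
Proof.
move=> [qm [sq _]] fm; rewrite size_monicM ?monic_neq0 //.
by move: sq; case: (size q) => [|[|n]] // _; rewrite !addSn /= ltnS leq_addl.
Qed.

Lemma monic_irr_dvdMl (q r f : {poly int}) :
  monic_irr q -> monic_irr r -> (q %| r * f) <-> q = r \/ q %| f.
Proof.
move=> qi ri; split=> [/(monic_irr_dvdM _ _ _ qi)/orP[/monic_irr_eq->|]|[->|]].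
- by left.
- by [].
- by [].
- by right.
- exact: dvdp_mulIl.
- exact: dvdp_mull.
Qed.

(** Split off an irreducible factor of [f]. It is coprime to its cofactor because [f] is squarefree,
    so the two can be shown to divide [g] separately. *)
Lemma squarefree_dvd (f g : {poly int}) : f \is monic ->
  (forall q, monic_irr q -> ~~ (q * q %| f)) ->
  (forall q, monic_irr q -> q %| f -> q %| g) -> f %| g.
Proof.
have [n] := ubnP (size f); elim: n f g => // n IHn f g sf fm sqf fg.
have [->|f1] := eqVneq f 1; first exact: dvd1p.
have [q [h [fE qi hm]]] := monic_irr_factor _ fm f1.
have qh : ~~ (q %| h).
  by apply: contra (sqf q qi) => qh; rewrite fE dvdp_mul2l // monic_neq0 ?qi.1.
rewrite fE Gauss_dvdp ?monic_irr_coprime //.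
rewrite fg ?fE ?dvdp_mulr //=; apply: IHn => //.
- by apply: leq_trans (size_monic_irrM _ _ qi hm) _; rewrite -ltnS -fE.
- by move=> r ri; apply: contra (sqf r ri) => rh; rewrite fE dvdp_mull.
- by move=> r ri rh; apply: fg => //; rewrite fE dvdp_mull.
Qed.

Lemma squarefree_monic_eq (f g : {poly int}) : f \is monic -> g \is monic ->
  (forall q, monic_irr q -> ~~ (q * q %| f)) ->
  (forall q, monic_irr q -> ~~ (q * q %| g)) ->
  (forall q, monic_irr q -> (q %| f) = (q %| g)) -> f = g.
Proof.
move=> fm gm sf sg fg; apply/eqP; rewrite -eqp_monic //; apply/andP.
by split; apply: squarefree_dvd => // q qi; rewrite fg.
Qed.

(** Gives the existence of Psi_n, with F_n for [f]. Irreducible factors are split off [f] one by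
    one; a factor is kept if it satisfies [A] and has not been kept before. *)
Lemma exists_irr_part (A : {poly int} -> Prop) (f : {poly int}) :
  f \is monic ->
  exists P : {poly int}, [/\ P \is monic,
    forall q, monic_irr q -> (q %| P) <-> (q %| f /\ A q)
    & forall q, monic_irr q -> ~~ (q * q %| P)].
Proof.
have [n] := ubnP (size f); elim: n f => // n IHn f sf fm.
have [->|f1] := eqVneq f 1.
  exists 1; split=> [|q qi|q qi]; first exact: monic1.
    by rewrite (negbTE (monic_irr_dvd1 _ qi)); split=> // -[].
  apply: contra (monic_irr_dvd1 _ qi); apply: dvdp_trans; exact: dvdp_mulr.
have [q [h [fE qi hm]]] := monic_irr_factor _ fm f1.
have [|P [Pm PA sP]] := IHn h _ hm.
  by apply: leq_trans (size_monic_irrM _ _ qi hm) _; rewrite -ltnS -fE.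
have [[Aq nqP]|nA] := classic (A q /\ ~~ (q %| P)).
  exists (q * P); split=> [|r ri|r ri].
  - by rewrite monicMl ?qi.1.
  - rewrite fE !monic_irr_dvdMl // PA //.
    split=> [[->|[rh Ar]]|[[->|rh] Ar]]; by [split; [left|]|split; [right|]|left|right].
  - have [->|rq] := eqVneq r q.
      by rewrite dvdp_mul2l // monic_neq0 ?qi.1.
    apply: contra (sP r ri); rewrite Gauss_dvdpr //.
    rewrite coprimepMl monic_irr_coprime // andbb.
    by apply: contra rq => /(monic_irr_eq _ _ ri qi)->.
exists P; split=> // r ri; rewrite PA // fE monic_irr_dvdMl //.
split=> [[rh Ar]|[[rq|//] Ar]]; first by split; [right|].
have qP : q %| P.
  by apply/idPn => nqP; apply: nA; rewrite -rq; split=> //; rewrite rq.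
by have [qh _] := (PA q qi).1 qP; rewrite rq in Ar *.
Qed.

(** * Fibonacci polynomials *)

Lemma fibpolySS n : fibpoly n.+2 = 'X * fibpoly n.+1 + fibpoly n.
Proof. by []. Qed.

Lemma fibpoly_monic_size n :
  fibpoly n.+1 \is monic /\ size (fibpoly n.+1) = n.+1.
Proof.
elim/ltn_ind: n => -[|[|n]] IHn.
- by rewrite /= monic1 size_poly1.
- by rewrite /= mulr1 addr0 monicX size_polyX.
have [m1 s1] := IHn n.+1 (leqnn _); have [_ s0] := IHn n (leqnSn _).
rewrite fibpolySS.
have sX : size ('X * fibpoly n.+2) = n.+3.
  by rewrite mulrC size_mulX ?monic_neq0 ?s1.
have lt : (size (fibpoly n.+1) < size ('X * fibpoly n.+2)%R)%N.
  by rewrite sX s0.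
split; last by rewrite size_polyDl.
by rewrite monicE lead_coefDl // -monicE monicMl ?monicX.
Qed.

Lemma fibpoly_monic n : (0 < n)%N -> fibpoly n \is monic.
Proof. by case: n => // n _; have [] := fibpoly_monic_size n. Qed.

Lemma fibpolyD m n :
  fibpoly (m + n).+1 = fibpoly m.+1 * fibpoly n.+1 + fibpoly m * fibpoly n.
Proof.
elim/ltn_ind: m => -[|[|m]] IHm.
- by rewrite /= mul1r mul0r addr0.
- by rewrite add1n !fibpolySS /=; ring.
rewrite !addSn fibpolySS -addSn !IHm // !fibpolySS; ring.
Qed.

(** By the recurrence, a common factor of two consecutive terms would descend to F_1 = 1. *)
Lemma fibpoly_consecutive (q : {poly int}) n :
  monic_irr q -> q %| fibpoly n -> ~~ (q %| fibpoly n.+1).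
Proof.
move=> qi; elim: n => [_|n IHn qn]; first exact: monic_irr_dvd1.
rewrite fibpolySS dvdp_addr ?dvdp_mull //.
by apply: contraTN qn; apply: IHn.
Qed.

Lemma fibpoly_dvd_mul (q : {poly int}) d t :
  q %| fibpoly d -> q %| fibpoly (t * d).
Proof.
move=> qd; elim: t => [|t IHt]; first by rewrite mul0n dvdp0.
case: d qd IHt => [|d] qd IHt; first by rewrite muln0 dvdp0.
by rewrite mulSn addSn fibpolyD dvdp_add ?(dvdp_mulr _ qd) ?(dvdp_mull _ IHt).
Qed.

(** Here [d] is the rank of apparition of [q]. With n = t d + r and r > 0, the addition formula
    gives F_n = F_(td+1) F_r modulo F_(td), and [q] divides neither factor. *)
Lemma fibpoly_dvd_min (q : {poly int}) d n : monic_irr q -> (0 < d)%N ->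
  (forall k, (0 < k < d)%N -> ~~ (q %| fibpoly k)) ->
  q %| fibpoly d -> (q %| fibpoly n) = (d %| n)%N.
Proof.
move=> qi d0 dmin qd.
apply/idP/idP => [|/dvdnP[t ->]]; last exact: fibpoly_dvd_mul.
rewrite {1}(divn_eq n d) /dvdn; set t := (n %/ d)%N.
have := dmin (n %% d)%N; rewrite ltn_mod d0 andbT.
case: (n %% d)%N => // r /(_ isT) nqr; rewrite addnS fibpolyD.
have qt : q %| fibpoly (t * d) by apply: fibpoly_dvd_mul.
rewrite (dvdp_addl _ (dvdp_mulr _ qt)) => /(monic_irr_dvdM _ _ _ qi).
by rewrite (negbTE nqr) (negbTE (fibpoly_consecutive _ _ qi qt)).
Qed.

(** The factor 2 F_(n+1) - x F_n is the Lucas polynomial F_(n+1) + F_(n-1), in a form that also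
    makes sense for n = 0. *)
Lemma fibpoly_deriv n :
  ('X ^+ 2 + 4%:R) * (fibpoly n)^`() =
    n%:R * (2%:R * fibpoly n.+1 - 'X * fibpoly n) - 'X * fibpoly n.
Proof.
elim/ltn_ind: n => -[|[|n]] IHn.
- by rewrite /= deriv0; ring.
- by rewrite /= -polyC1 derivC; ring.
have -> : (fibpoly n.+2)^`() =
  fibpoly n.+1 + 'X * (fibpoly n.+1)^`() + (fibpoly n)^`().
  by rewrite fibpolySS derivD derivM derivX mul1r.
have IH1 := IHn n.+1 (leqnn _); have IH0 := IHn n (leqnSn _).
have distr (a b c d : {poly int}) :
  a * (b + 'X * c + d) = a * b + 'X * (a * c) + a * d by ring.
rewrite distr IH1 IH0 !fibpolySS -[n.+2%:R]natr1 -[n.+1%:R]natr1.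
by move: (fibpoly n) (fibpoly n.+1) => u v; ring.
Qed.

Lemma fibpoly_squarefree n (q : {poly int}) :
  (0 < n)%N -> monic_irr q -> ~~ (q * q %| fibpoly n).
Proof.
move=> n0 qi; apply/negP => qq.
have q0 : q %| fibpoly n by apply: dvdp_trans qq; apply: dvdp_mulr.
have qm := qi.1.
have qd : q %| (fibpoly n)^`().
  have qqm : q * q \is monic by rewrite monicMl.
  have /(Pdiv.IdomainMonic.dvdpP qqm)[g ->] := qq.
  rewrite mulrA derivM; apply: dvdp_add; first exact: dvdp_mulIr.
  by apply/dvdp_mulr/dvdp_mulIr.
(* Since [q] divides both F_n and its derivative, the differential identity leaves only this
   term. *)
have: q %| n%:R * (2%:R * fibpoly n.+1).
  have -> : n%:R * (2%:R * fibpoly n.+1) =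
    ('X ^+ 2 + 4%:R) * (fibpoly n)^`() + (n.+1%:R * 'X) * fibpoly n.
    by rewrite fibpoly_deriv -natr1; ring.
  by rewrite dvdp_add ?(dvdp_mull _ qd) ?(dvdp_mull _ q0).
(* A nonzero constant is a unit for divisibility over the rationals. *)
have qc (c : nat) : (0 < c)%N -> (q %| c%:R) = false.
  move=> c0; apply/negbTE; have := monic_irr_dvd1 _ qi; apply: contra.
  by rewrite -polyC_natr -alg_polyC dvdpZr // pnatr_eq0 -lt0n.
move=> /(monic_irr_dvdM _ _ _ qi); rewrite qc //=.
move=> /(monic_irr_dvdM _ _ _ qi); rewrite qc //=.
by rewrite (negbTE (fibpoly_consecutive _ _ qi q0)).
Qed.

(** * Fibotomic polynomials *)

(** A polynomial with the defining property exists, so [epsilon] selects one. *)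
Lemma fibotomicP n : is_fibotomic n (fibotomic n).
Proof.
apply: epsilon_spec; rewrite /is_fibotomic.
case: leqP => [_|n1]; first by exists 1.
pose A q := forall k, (0 < k < n)%N -> ~ zdvdp q (fibpoly k).
have n0 : (0 < n)%N by apply: leq_trans n1.
have [P [Pm PA sP]] := exists_irr_part A _ (fibpoly_monic _ n0).
exists P; split=> // q qi; first by rewrite !zdvdpP ?qi.1 // PA.
rewrite zdvdpP ?monicMl ?qi.1 //; exact/negP/sP.
Qed.

Lemma fibotomic_monic n : fibotomic n \is monic.
Proof.
have := fibotomicP n; rewrite /is_fibotomic.
by case: leqP => _ => [->|[]//]; apply: monic1.
Qed.

Lemma fibotomic_squarefree n q : monic_irr q -> ~~ (q * q %| fibotomic n).
Proof.
move=> qi; have := fibotomicP n; rewrite /is_fibotomic.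
case: leqP => _ => [->|[_ _ /(_ q qi)]].
  apply: contra (monic_irr_dvd1 _ qi); apply: dvdp_trans; exact: dvdp_mulr.
by rewrite zdvdpP ?monicMl ?qi.1 // => /negP.
Qed.

Lemma monic_irr_dvd_fibotomic n q : (0 < n)%N -> monic_irr q ->
  (q %| fibotomic n) <->
  (q %| fibpoly n /\ forall k, (0 < k < n)%N -> ~~ (q %| fibpoly k)).
Proof.
move=> n0 qi; have := fibotomicP n; rewrite /is_fibotomic.
case: leqP => [n1 ->|n1 [_ /(_ q qi) + _]].
  have -> : n = 1%N by apply/eqP; rewrite eqn_leq n1 n0.
  by rewrite /= (negbTE (monic_irr_dvd1 _ qi)); split=> // -[].
rewrite !zdvdpP ?qi.1 // => ->; split=> -[-> H]; split=> // k /H.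
  by rewrite zdvdpP ?qi.1 // => /negP.
by move=> /negP; rewrite zdvdpP ?qi.1.
Qed.

Lemma monic_irr_dvd_prod (I : eqType) (r : seq I) (f : I -> {poly int}) q :
  monic_irr q -> (q %| \prod_(i <- r) f i) = has (fun i => q %| f i) r.
Proof.
move=> qi; elim: r => [|i r IHr].
  by rewrite big_nil (negbTE (monic_irr_dvd1 _ qi)).
rewrite big_cons /= -IHr; apply/idP/idP; first exact: monic_irr_dvdM.
by case/orP=> ?; [apply: dvdp_mulr|apply: dvdp_mull].
Qed.

(** Both indices are the rank of apparition of [q]. *)
Lemma fibotomic_disjoint q d e : (0 < d)%N -> (0 < e)%N -> monic_irr q ->
  q %| fibotomic d -> q %| fibotomic e -> d = e.
Proof.
move=> d0 e0 qi /(monic_irr_dvd_fibotomic _ _ d0 qi)[qd nd].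
move=> /(monic_irr_dvd_fibotomic _ _ e0 qi)[qe ne].
case: (ltngtP d e) => // lt.
  by have := ne d; rewrite d0 lt qd => /(_ isT).
by have := nd e; rewrite e0 lt qe => /(_ isT).
Qed.

Lemma prod_fibotomic_squarefree (r : seq nat) q : uniq r -> all (leq 1) r ->
  monic_irr q -> ~~ (q * q %| \prod_(d <- r) fibotomic d).
Proof.
move=> + + qi; elim: r => [_ _|d r IHr].
  rewrite big_nil; apply: contra (monic_irr_dvd1 _ qi).
  by apply: dvdp_trans; apply: dvdp_mulr.
rewrite big_cons => /andP[nd ur] /andP[d0 r0].
have [qr|nqr] := boolP (q %| \prod_(e <- r) fibotomic e); last first.
  rewrite Gauss_dvdpl ?fibotomic_squarefree //.
  by rewrite coprimepMl monic_irr_coprime // nqr.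
rewrite Gauss_dvdpr ?IHr //; rewrite coprimepMl monic_irr_coprime // andbb.
apply: contra nd => qd; move: qr; rewrite monic_irr_dvd_prod //.
case/hasP=> e er qe.
by rewrite (fibotomic_disjoint _ _ _ d0 (allP r0 e er) qi qd qe).
Qed.

(** Both sides are monic and squarefree, so it is enough to compare irreducible factors: [q] divides
    F_n exactly when its rank of apparition divides [n]. *)
Lemma prod_fibotomic n : (0 < n)%N ->
  \prod_(d <- divisors n) fibotomic d = fibpoly n.
Proof.
move=> n0; have dpos d : d \in divisors n -> (0 < d)%N.
  by rewrite -dvdn_divisors // => /dvdn_gt0->.
apply: squarefree_monic_eq; rewrite ?fibpoly_monic //.
- by apply: monic_prod => d _; apply: fibotomic_monic.
- move=> q; apply: prod_fibotomic_squarefree; first exact: divisors_uniq.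
  exact/allP.
- by move=> q; apply: fibpoly_squarefree.
move=> q qi; rewrite monic_irr_dvd_prod //; apply/hasP/idP.
  move=> [d dn qd]; have d0 := dpos d dn.
  have [qFd dmin] := (monic_irr_dvd_fibotomic _ _ d0 qi).1 qd.
  by rewrite (fibpoly_dvd_min _ _ _ qi d0 dmin qFd) dvdn_divisors.
move=> qn; have exP : exists d, (0 < d)%N && (q %| fibpoly d).
  by exists n; rewrite n0.
(* This [d] is the rank of apparition of [q]. *)
case: (ex_minnP exP) => d /andP[d0 qd] dmin'.
have dmin k : (0 < k < d)%N -> ~~ (q %| fibpoly k).
  case/andP=> k0 kd; apply: contraL kd => qk.
  by rewrite -leqNgt dmin' // k0.
exists d; last exact/(monic_irr_dvd_fibotomic _ _ d0 qi).
by rewrite -dvdn_divisors // -(fibpoly_dvd_min _ _ _ qi d0 dmin qd).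
Qed.

(** * Reduction modulo a prime *)

Definition redp p (f : {poly int}) : {poly 'F_p} := map_poly intr f.

Lemma redpM p f g : redp p (f * g) = redp p f * redp p g.
Proof. exact: rmorphM. Qed.

Lemma redp_monic p f : f \is monic -> redp p f \is monic.
Proof. exact: monic_map. Qed.

Lemma redp_prod p (I : Type) (r : seq I) (f : I -> {poly int}) :
  redp p (\prod_(i <- r) f i) = \prod_(i <- r) redp p (f i).
Proof. exact: rmorph_prod. Qed.

Lemma redp_fibpoly0 p : redp p (fibpoly 0) = 0.
Proof. exact: rmorph0. Qed.

Lemma redp_fibpoly1 p : redp p (fibpoly 1) = 1.
Proof. exact: rmorph1. Qed.

Lemma redp_fibpolySS p n : redp p (fibpoly n.+2) =
  'X * redp p (fibpoly n.+1) + redp p (fibpoly n).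
Proof. by rewrite fibpolySS /redp rmorphD rmorphM /= map_polyX. Qed.

Definition fib_mx p : 'M[{poly 'F_p}]_2 :=
  \matrix_(i, j) (if (i == 0) && (j == 0) then 'X else (i != j)%:R).

(** The Cayley-Hamilton identity for trace x and determinant -1. *)
Lemma fib_mx_sqr p : fib_mx p * fib_mx p = 'X *: fib_mx p + 1.
Proof.
apply/matrixP=> i j; rewrite !mxE big_ord_recl big_ord1 !mxE.
case: i => -[|[|//]] i; case: j => -[|[|//]] j; rewrite -!val_eqE /=; ring.
Qed.

(** The exponent starts at 1 because exponent 0 would call for F_(-1). *)
Lemma fib_mx_exp p n : fib_mx p ^+ n.+1 =
  redp p (fibpoly n.+1) *: fib_mx p + redp p (fibpoly n) *: 1.
Proof.
elim: n => [|n IHn].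
  by rewrite expr1 redp_fibpoly1 redp_fibpoly0 scale1r scale0r addr0.
rewrite exprS IHn mulrDr -!scalerAr fib_mx_sqr mulr1 redp_fibpolySS.
rewrite scalerDr scalerA scalerDl [_ * 'X]mulrC -!addrA; congr (_ + _).
exact: addrC.
Qed.

Lemma fib_mx_exp01 p n : (fib_mx p ^+ n) 0 1 = redp p (fibpoly n).
Proof.
case: n => [|n]; first by rewrite expr0 mxE redp_fibpoly0.
by rewrite fib_mx_exp !mxE /= mulr1 mulr0 addr0.
Qed.

(* The powers of the Fibonacci matrix are combinations of the matrix and the
   identity, on which the Frobenius map is additive. *)
Lemma redp_fibpoly_mulp p n : prime p ->
  redp p (fibpoly (p * n)) = redp p (fibpoly p) * redp p (fibpoly n) ^+ p.
Proof.
move=> pp; case: n => [|n].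
  by rewrite muln0 redp_fibpoly0 expr0n eqn0Ngt prime_gt0 // mulr0.
have chM : p \in [pchar 'M[{poly 'F_p}]_2].
  rewrite inE pp /= -scaler_nat; apply/eqP.
  have -> : p%:R = 0 :> {poly 'F_p}.
    by apply/eqP; rewrite -(dvdn_pcharf (_ : p \in [pchar {poly 'F_p}])) // pchar_poly pchar_Fp.
  exact: scale0r.
rewrite -fib_mx_exp01 mulnC exprM fib_mx_exp -(pFrobenius_autE chM).
(* The matrix ring is not commutative, but the two summands commute. Their p-th powers add up to
   F_(n+1)^p M^p + F_n^p, whose off-diagonal entry is F_(n+1)^p F_p. *)
rewrite pFrobenius_autD_comm; last first.
  by rewrite /GRing.comm -!scalerAl -!scalerAr mul1r mulr1 !scalerA [_ * redp p _]mulrC.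
rewrite !pFrobenius_autE !exprZn expr1n !mxE /= mulr0 addr0 fib_mx_exp01.
exact: mulrC.
Qed.

Lemma redp_fibpoly_mulXp p k m : prime p ->
  redp p (fibpoly (p ^ k * m)) =
    redp p (fibpoly (p ^ k)) * redp p (fibpoly m) ^+ (p ^ k).
Proof.
move=> pp; elim: k => [|k IHk]; first by rewrite mul1n redp_fibpoly1 mul1r.
rewrite !expnS -mulnA !redp_fibpoly_mulp // IHk exprMn -exprM mulrA.
by rewrite [(p ^ k * p)%N]mulnC.
Qed.

(** The divisors are separated by whether p^(k+1) divides them. *)
Lemma divisors_pfactor_mul p k m : prime p -> (0 < m)%N -> coprime p m ->
  perm_eq (divisors (p ^ k.+1 * m))
    (divisors (p ^ k * m) ++ [seq (p ^ k.+1 * d)%N | d <- divisors m]).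
Proof.
move=> pp m0 pm; have p0 := prime_gt0 pp.
have pX0 j : (0 < p ^ j)%N by rewrite expn_gt0 p0.
have mulI : injective (muln (p ^ k.+1)).
  by move=> x y /eqP; rewrite eqn_pmul2l // => /eqP.
apply: uniq_perm; first exact: divisors_uniq.
  rewrite cat_uniq divisors_uniq (map_inj_uniq mulI) divisors_uniq andbT /=.
  apply/hasPn => _ /mapP[e _ ->].
  rewrite -dvdn_divisors ?muln_gt0 ?pX0 // expnSr -mulnA dvdn_pmul2l //.
  apply: contraL pm => pem; rewrite prime_coprime // negbK.
  exact: dvdn_trans (dvdn_mulr _ (dvdnn p)) pem.
move=> d; rewrite mem_cat -!dvdn_divisors ?muln_gt0 ?pX0 //.
apply/idP/orP => [dpm|[dpm|/mapP[e em ->]]]; first last.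
- by rewrite dvdn_pmul2l // dvdn_divisors.
- by apply: dvdn_trans dpm _; rewrite dvdn_mul // dvdn_exp2l.
have [/dvdnP[e dE]|npd] := boolP (p ^ k.+1 %| d)%N; [right|left].
  apply/mapP; exists e; last by rewrite mulnC.
  by rewrite -dvdn_divisors // -(dvdn_pmul2l (pX0 k.+1)) mulnC -dE.
have d0 : (0 < d)%N by apply: dvdn_gt0 dpm; rewrite muln_gt0 pX0.
(* Write d = e p^v with [e] prime to [p]; then [e] divides [m], and v <= k since p^(k+1) does not
   divide [d]. *)
have [e pe dE] := pfactor_coprime pp d0.
have edvd : (e %| m)%N.
  have : (e %| p ^ k.+1 * m)%N by apply: dvdn_trans dpm; rewrite dE dvdn_mulr.
  by rewrite Gauss_dvdr // coprimeXr // coprime_sym.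
rewrite dE mulnC dvdn_mul // dvdn_exp2l // leqNgt.
by apply: contra npd => lt; rewrite dE dvdn_mull // dvdn_exp2l.
Qed.

Lemma redp_prod_fibotomic_pfactor p k m :
  prime p -> (0 < m)%N -> coprime p m ->
  \prod_(d <- divisors m) redp p (fibotomic (p ^ k.+1 * d)) =
    redp p (fibpoly p) * redp p (fibpoly (p ^ k * m)) ^+ p.-1.
Proof.
move=> pp m0 pm; have p0 := prime_gt0 pp.
have pkm0 : (0 < p ^ k * m)%N by rewrite muln_gt0 expn_gt0 p0.
have F0 : redp p (fibpoly (p ^ k * m)) != 0.
  by rewrite monic_neq0 // redp_monic // fibpoly_monic.
(* Multiplying by F_(p^k m) turns the right side into F_(p^(k+1) m) and restores the missing
   divisors on the left. *)
apply: (mulfI F0); rewrite mulrCA -exprS prednK // -redp_fibpoly_mulp //.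
rewrite mulnA -expnS -(prod_fibotomic (p ^ k.+1 * m)); last first.
  by rewrite muln_gt0 expn_gt0 p0.
rewrite (perm_big _ (divisors_pfactor_mul _ _ _ pp m0 pm)) big_cat big_map /=.
by rewrite prod_fibotomic // redpM redp_prod.
Qed.

(** As in Möbius inversion, divisor products determine their terms: by strong induction the proper
    divisors contribute the same nonzero factor on both sides. *)
Lemma eq_prod_divisors (R : idomainType) (p : nat) (a b : nat -> R) :
  (forall n, b n != 0) ->
  (forall m, (0 < m)%N -> coprime p m ->
    \prod_(d <- divisors m) a d = \prod_(d <- divisors m) b d) ->
  forall m, (0 < m)%N -> coprime p m -> a m = b m.
Proof.
move=> b0 ab; elim/ltn_ind => m IHm m0 pm.
have := ab m m0 pm.
rewrite !(bigD1_seq m) ?divisors_uniq -?dvdn_divisors //=.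
have -> : \prod_(d <- divisors m | d != m) a d =
          \prod_(d <- divisors m | d != m) b d.
  rewrite big_seq_cond [RHS]big_seq_cond; apply: eq_bigr => d /andP[].
  rewrite -dvdn_divisors // => dm dnm; apply: IHm.
  - by rewrite ltn_neqAle dnm dvdn_leq.
  - exact: dvdn_gt0 dm.
  - exact: coprime_dvdr dm pm.
by apply: mulIf; rewrite prodf_seq_neq0; apply/allP=> d _; rewrite b0 implybT.
Qed.

Lemma redp_fibotomic_pfactor p k m : prime p -> (2 <= m)%N -> coprime p m ->
  redp p (fibotomic (p ^ k.+1 * m)) =
    redp p (fibotomic m) ^+ totient (p ^ k.+1).
Proof.
move=> pp m2 pm; set t := totient _.
have psi0 n : redp p (fibotomic n) != 0.
  by rewrite monic_neq0 // redp_monic // fibotomic_monic.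
pose c := redp p (fibotomic (p ^ k.+1)).
(* The term at d = 1 must be Psi_(p^(k+1)), while Psi_1 = 1; the factor [c] corrects this and is
   absent at [m], as m >= 2. *)
pose b d := (if d == 1%N then c else 1) * redp p (fibotomic d) ^+ t.
have -> : redp p (fibotomic m) ^+ t = b m.
  by rewrite /b; case: eqP m2 => [->|_ _] //; rewrite mul1r.
apply: (eq_prod_divisors _ p (fun d => redp p (fibotomic (p ^ k.+1 * d))) b);
  [move=> n|move=> n n0 pn|exact: ltnW|exact: pm].
  by rewrite mulf_neq0 ?expf_neq0 //; case: ifP; rewrite ?psi0 ?oner_neq0.
(* This is the divisor product formula for m = 1. *)
have cE : c = redp p (fibpoly p) * redp p (fibpoly (p ^ k)) ^+ p.-1.
  have := redp_prod_fibotomic_pfactor _ k 1 pp isT (coprimen1 p).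
  by rewrite big_seq1 !muln1.
rewrite redp_prod_fibotomic_pfactor // redp_fibpoly_mulXp // exprMn mulrA -cE.
(* The correction factors multiply to [c]; the powers of Psi_d multiply to F_n^t, with t = p^k (p -
   1). *)
rewrite big_split /= -exprM; congr (_ * _).
  rewrite (bigD1_seq 1%N) ?divisors_uniq -?dvdn_divisors ?dvd1n //=.
  by rewrite big1 ?mulr1 // => d /negbTE->.
rewrite prodrXl -redp_prod prod_fibotomic //; congr (_ ^+ _).
by rewrite /t totient_pfactor // mulnC.
Qed.

Lemma redp_eq_coef p f g i : prime p -> redp p f = redp p g ->
  (f`_i == g`_i %[mod (p : int)])%Z.
Proof.
move=> pp /(congr1 (fun h : {poly 'F_p} => h`_i)); rewrite !coef_map /= => fg.
by rewrite eqz_mod_dvd (dvdz_pcharf (pchar_Fp pp)) rmorphB /= fg subrr.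
Qed.

Theorem mainTheorem12 (p m k : nat) :
  prime p -> (2 <= m)%N -> coprime p m ->
  forall i : nat,
    ((fibotomic (p ^ k * m))`_i
       == ((fibotomic m) ^+ totient (p ^ k))`_i %[mod (p : int)])%Z.
Proof.
move=> pp m2 pm i; apply: redp_eq_coef => //.
case: k => [|k]; first by rewrite mul1n expr1.
by rewrite redp_fibotomic_pfactor // /redp rmorphXn.
Qed.
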